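(* For any scalar $0<\epsilon<1$ and any integer $n\geq2$, with $T_n$ the Chebyshev polynomial of the first kind of degree $n$ on $[-1,1]$, there is a deep ReLU network $\widetilde{T}_n$ with inputs $(x_1,\ldots,x_n)\in[-1,1]^n$ that has depth $$L=\mathcal{O}\left(n\log_2\frac{n}{\epsilon}+n^2\right)$$ and size $$W=\mathcal{O}\left(n\log_2\frac{n}{\epsilon}+n^2\right),$$ such that $$\left\Vert\widetilde{T}_n(x,\ldots,x)-T_n(x)\right\Vert_{L^\infty([-1,1])}\leq\epsilon.$$
   Context: **Chebyshev polynomials.** $T_0=1$, $T_1(x)=x$ and $T_n(x)=2xT_{n-1}(x)-T_{n-2}(x)$ for $n\geq2$. **Deep ReLU networks.** Let $\sigma(x)=\max(0,x)$. A deep ReLU network has input variables and units arranged in successive hidden layers; each unit computes $\sigma(\boldsymbol{w}\cdot\boldsymbol{z}+\theta)$ with real weights $\boldsymbol{w},\theta$, where $\boldsymbol{z}$ collects network inputs and outputs of units in preceding layers (connections between non-neighboring layers are allowed). The output is an affine combination (real coefficients) of the network inputs and the outputs of the units. The depth $L$ is the number of hidden layers and the size $W$ is the total number of units. The notation $\widetilde{T}_n(x,\ldots,x)$ means that all $n$ inputs are set equal to the same $x$. **$\mathcal{O}$ convention.** Depth or size $\mathcal{O}(X)$ means it is at most $cX$ for an absolute constant $c$ (independent of $n$ and $\epsilon$). *)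

(* Defs.v *)
From HB Require Import structures.
From mathcomp Require Import all_boot all_order all_algebra.
From mathcomp Require Import all_classical all_reals all_analysis.
Import Order.TTheory GRing.Theory Num.Theory.
Import numFieldNormedType.Exports.

Set Implicit Arguments.
Unset Strict Implicit.
Unset Printing Implicit Defensive.

Local Open Scope classical_set_scope.
Local Open Scope ring_scope.

Fixpoint chebyshevT (R : nzRingType) (n : nat) : {poly R} :=
  match n with
  | 0 => 1
  | n1.+1 => match n1 with
             | 0 => 'X
             | n2.+1 => 2%:R *: 'X * chebyshevT R n1 - chebyshevT R n2
             end
  end.

Definition relu (R : realType) (x : R) : R := Num.max 0 x.

(* [relu_net R m] is a network reading [m] available values: at the root these
   are the network inputs, and every hidden layer appends the outputs of its
   units to them. A unit therefore sees all inputs and all units of all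
   preceding layers, so connections between non-neighbouring layers are
   allowed, and a missing connection is a zero weight. A hidden layer has
   [k.+1] units, i.e. it is nonempty; row [i] of [w] and entry [i] of [theta]
   are the weights and the bias of its [i]-th unit. *)
Inductive relu_net (R : realType) : nat -> Type :=
| Output (m : nat) (a : 'rV[R]_m) (b : R) : relu_net R m
| Hidden (m k : nat) (w : 'M[R]_(k.+1, m)) (theta : 'cV[R]_k.+1)
    (N : relu_net R (m + k.+1)) : relu_net R m.

Fixpoint net_eval (R : realType) (m : nat) (N : relu_net R m) :
    'cV[R]_m -> R :=
  match N in relu_net _ m return 'cV[R]_m -> R with
  | Output _ a b => fun z => (a *m z) 0 0 + b
  | Hidden _ _ w theta N' =>
      fun z => net_eval N' (col_mx z (map_mx (@relu R) (w *m z + theta)))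
  end.

Fixpoint net_depth (R : realType) (m : nat) (N : relu_net R m) : nat :=
  match N with
  | Output _ _ _ => 0
  | Hidden _ _ _ _ N' => (net_depth N').+1
  end.

Fixpoint net_size (R : realType) (m : nat) (N : relu_net R m) : nat :=
  match N with
  | Output _ _ _ => 0
  | Hidden _ k _ _ N' => (k.+1 + net_size N')%N
  end.

Definition log2 (R : realType) (x : R) : R := ln x / ln 2.

(* [f \_ A] vanishes outside [A], so the essential supremum of its absolute
   value over the whole line is the norm of [f] in L^oo(A). *)
Definition Linfty_norm (R : realType) (A : set R) (f : R -> R) : \bar R :=
  Lnorm (@lebesgue_measure R) +oo%E (EFin \o (f \_ A)).

(* Main.v *)
Require Import Defs.
From HB Require Import structures.
From mathcomp Require Import all_boot all_order all_algebra.
From mathcomp Require Import all_classical all_reals all_analysis.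
From mathcomp Require Import ess_sup_inf ring lra.
Import Order.TTheory GRing.Theory Num.Theory.
Import numFieldNormedType.Exports.
Local Open Scope classical_set_scope.
Local Open Scope ring_scope.

Set Implicit Arguments.
Unset Strict Implicit.
Unset Printing Implicit Defensive.

(** The network runs the three-term recurrence
    [T_(k+2) = 2 x T_(k+1) - T_k] with the product replaced by an approximate
    one. The identity [w ^+ 2 = (1 + 2 z + z ^+ 2) / 4], where
    [z = 2 `|w| - 1], maps the squaring problem on [[-1, 1]] to itself and
    divides the error by 4, at the price of a single unit computing [`|w|];
    [d] iterations thus square with error at most [4 ^- d]
    ([sqr_approx_err]). Polarization then multiplies [x] and [y] with error at
    most [8 * 4 ^- d] using [2 d] units, when [`|x| <= 1] and [`|y| <= 2]
    ([mul_approx_err]).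

    On [[-1, 1]] one has [`|T_k| <= 1], so as long as the accumulated error
    is at most 1, the approximate values are at most 2 in norm and the error
    [e_k] of the recurrence obeys [e_(k+2) <= 2 e_(k+1) + e_k + 16 * 4 ^- d],
    whence [e_k <= 4 ^+ k * 16 * 4 ^- d] ([cheb_approx_err]). With
    [d = n + 2 + j] and [eps^-1 <= 2 ^+ j], [j] of the order of
    [log2 eps^-1], the final error is at most [4 ^- j <= eps], and the network
    has [2 d (n - 1)] units. Each hidden layer may be taken to consist of one
    unit, so depth and size coincide and it is enough to bound the size. *)

(** * Values available in a network *)

(** [f] is an affine combination of the values [G x] held by the network when
    all its inputs equal [x]. *)
Definition affine_in {R : realType} {m : nat} (G : R -> 'cV[R]_m)
    (f : R -> R) : Prop :=
  exists (a : 'rV[R]_m) (b : R), forall x, f x = (a *m G x) 0 0 + b.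

(** [s] units turn the available values [G] into the available values [G']:
    nothing is lost, and any network reading [G'] can be simulated by one
    reading [G] with [s] more units. *)
Definition extends {R : realType} (s : nat) {m m' : nat}
    (G : R -> 'cV[R]_m) (G' : R -> 'cV[R]_m') : Prop :=
  (forall f, affine_in G f -> affine_in G' f) /\
  forall N' : relu_net R m', exists N : relu_net R m,
    (forall x, net_eval N (G x) = net_eval N' (G' x)) /\
    net_size N = (s + net_size N')%N.

(** [f] becomes available after adding [s] units to a network holding [G]. *)
Definition reaches {R : realType} (s : nat) {m : nat} (G : R -> 'cV[R]_m)
    (f : R -> R) : Prop :=
  exists m' (G' : R -> 'cV[R]_m'), extends s G G' /\ affine_in G' f.

Lemma net_depth_le_size {R : realType} m (N : relu_net R m) :
  (net_depth N <= net_size N)%N.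
Proof.
elim: N => //= {}m k w theta N IH.
by rewrite addSn ltnS (leq_trans IH) // leq_addl.
Qed.

Lemma affine_in_ext {R : realType} m (G : R -> 'cV[R]_m) (f g : R -> R) :
  f =1 g -> affine_in G f -> affine_in G g.
Proof. by move=> fg [a [b fE]]; exists a, b => x; rewrite -fg. Qed.

Lemma affine_in_cst {R : realType} m (G : R -> 'cV[R]_m) (c : R) :
  affine_in G (fun=> c).
Proof. by exists 0, c => x; rewrite mul0mx mxE add0r. Qed.

Lemma affine_in_input {R : realType} n :
  affine_in (fun x : R => const_mx x : 'cV[R]_n.+1) id.
Proof.
exists (delta_mx 0 0), 0 => x.
by rewrite -rowE !mxE addr0.
Qed.

Lemma affine_in_lin {R : realType} m (G : R -> 'cV[R]_m) (c d : R)
    (f g : R -> R) :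
  affine_in G f -> affine_in G g -> affine_in G (fun x => c * f x + d * g x).
Proof.
move=> [a [b fE]] [a' [b' gE]]; exists (c *: a + d *: a'), (c * b + d * b').
move=> x; rewrite mulmxDl -!scalemxAl fE gE.
by move: (a *m G x) (a' *m G x) => u u'; rewrite !mxE; ring.
Qed.

Lemma extends_refl {R : realType} m (G : R -> 'cV[R]_m) : extends 0 G G.
Proof. by split=> // N; exists N. Qed.

Lemma extends_trans {R : realType} s s' m m' m'' (G : R -> 'cV[R]_m)
    (G' : R -> 'cV[R]_m') (G'' : R -> 'cV[R]_m'') :
  extends s G G' -> extends s' G' G'' -> extends (s + s') G G''.
Proof.
move=> [sub1 sim1] [sub2 sim2]; split=> [f /sub1 /sub2 //|N''].
have [N' [eN' sN']] := sim2 N''; have [N [eN sN]] := sim1 N'.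
by exists N; split=> [x|]; rewrite ?eN ?eN' // sN sN' addnA.
Qed.

Lemma reaches_relu {R : realType} m (G : R -> 'cV[R]_m) f :
  affine_in G f -> reaches 1 G (fun x => relu (f x)).
Proof.
move=> [a [b fE]].
exists (m + 1)%N, (fun x => col_mx (G x) (const_mx (relu (f x)))).
split; first split.
- move=> g [c [d gE]]; exists (row_mx c 0), d => x.
  by rewrite mul_row_col mul0mx addr0 gE.
- move=> N'; exists (Hidden a (const_mx b) N'); split=> //= x.
  congr (net_eval N' (col_mx _ _)).
  by apply/matrixP => i j; rewrite !ord1 !mxE fE !mxE.
- exists (row_mx 0 1%:M), 0 => x.
  by rewrite mul_row_col mul0mx mul1mx add0r mxE addr0.
Qed.

(** A single unit suffices, because [`|y| = 2 * relu y - y]. *)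
Lemma reaches_abs {R : realType} m (G : R -> 'cV[R]_m) f :
  affine_in G f -> reaches 1 G (fun x => `|f x|).
Proof.
move=> Gf; have [m' [G' [ext Gr]]] := reaches_relu Gf.
exists m', G'; split=> //.
apply: affine_in_ext (affine_in_lin 2 (-1) Gr (ext.1 _ Gf)) => x /=.
rewrite /relu; case: (lerP 0 (f x)) => f0; last by rewrite ltr0_norm //; ring.
by rewrite ger0_norm //; ring.
Qed.

(** * Approximate squaring and multiplication *)

(** Squaring on [[-1, 1]], up to an error [4 ^- d]. *)
Fixpoint sqr_approx {R : realType} (d : nat) (w : R) : R :=
  if d is d'.+1 then
    let z := 2 * `|w| - 1 in (1 + 2 * z + sqr_approx d' z) / 4
  else 0.

Lemma sqr_approx_err {R : realType} d (w : R) :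
  `|w| <= 1 -> `|sqr_approx d w - w ^+ 2| <= 4^-1 ^+ d.
Proof.
elim: d w => [|d IH] w w1 /=.
  by rewrite expr0 sub0r normrN normrX expr_le1.
set z := 2 * `|w| - 1.
have z1 : `|z| <= 1 by rewrite ler_norml /z; have := normr_ge0 w; lra.
have -> : (1 + 2 * z + sqr_approx d z) / 4 - w ^+ 2
    = 4^-1 * (sqr_approx d z - z ^+ 2).
  by rewrite -(real_normK (num_real w)) /z; field.
by rewrite normrM ger0_norm ?invr_ge0 // [leRHS]exprS ler_wpM2l ?invr_ge0 ?IH.
Qed.

Lemma reaches_sqr_approx {R : realType} d m (G : R -> 'cV[R]_m) f :
  affine_in G f -> reaches d G (fun x => sqr_approx d (f x)).
Proof.
elim: d m G f => [|d IH] m G f Gf.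
  exists m, G; split; [exact: extends_refl | exact: affine_in_cst].
have [m1 [G1 [ext1 Gabs]]] := reaches_abs Gf.
have Gz := affine_in_lin 2 (-1) Gabs (affine_in_cst G1 1).
have [m2 [G2 [ext2 Gsqr]]] := IH _ _ _ Gz.
exists m2, G2; split; first by rewrite -add1n; exact: extends_trans ext2.
have := affine_in_lin (2 / 4) (1 / 4) (ext2.1 _ Gz) Gsqr.
move=> /(affine_in_lin (1 / 4) 1 (affine_in_cst G2 1)).
apply: affine_in_ext => x /=.
by rewrite mulN1r; field.
Qed.

(** Multiplication by polarization; the scaling by 4 brings the sum and the
    difference of [x] and [y] back to [[-1, 1]]. *)
Definition mul_approx {R : realType} (d : nat) (x y : R) : R :=
  4 * (sqr_approx d ((x + y) / 4) - sqr_approx d ((x - y) / 4)).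

Lemma mul_approx_err {R : realType} d (x y : R) :
  `|x| <= 1 -> `|y| <= 2 -> `|mul_approx d x y - x * y| <= 8 * 4^-1 ^+ d.
Proof.
rewrite !ler_norml => /andP[x1 x2] /andP[y1 y2].
have /sqr_approx_err : `|(x + y) / 4| <= 1 by rewrite ler_norml; lra.
have /sqr_approx_err : `|(x - y) / 4| <= 1 by rewrite ler_norml; lra.
move=> /(_ d) + /(_ d); rewrite /mul_approx !ler_norml.
set p := sqr_approx d _; set q := sqr_approx d _; set e := _ ^+ d.
have -> : x * y = 4 * (((x + y) / 4) ^+ 2 - ((x - y) / 4) ^+ 2) by field.
by move: (((x + y) / 4) ^+ 2) (((x - y) / 4) ^+ 2) => u v; lra.
Qed.

Lemma reaches_mul_approx {R : realType} d m (G : R -> 'cV[R]_m) f g :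
  affine_in G f -> affine_in G g ->
  reaches (d + d) G (fun x => mul_approx d (f x) (g x)).
Proof.
move=> Gf Gg.
have [m1 [G1 [ext1 Gp]]] :=
  reaches_sqr_approx d (affine_in_lin (4^-1) (4^-1) Gf Gg).
have [m2 [G2 [ext2 Gq]]] :=
  reaches_sqr_approx d (ext1.1 _ (affine_in_lin (4^-1) (- 4^-1) Gf Gg)).
exists m2, G2; split; first exact: extends_trans ext2.
apply: affine_in_ext (affine_in_lin 4 (-4) (ext2.1 _ Gp) Gq) => x /=.
rewrite /mul_approx mulrBr mulNr.
by congr (_ * sqr_approx d _ - _ * sqr_approx d _); ring.
Qed.

(** * Approximate Chebyshev recurrence *)

(** The pair of the [k]-th and [k+1]-st terms of the Chebyshev recurrence at
    [x], computed with approximate products. *)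
Fixpoint cheb_approx {R : realType} (d k : nat) (x : R) : R * R :=
  if k is k'.+1 then
    let t := cheb_approx d k' x in (t.2, 2 * mul_approx d x t.2 - t.1)
  else (1, x).

(** Each step of the recurrence costs one product, that is [2 d] units. *)
Lemma reaches_cheb_approx {R : realType} d k m (G : R -> 'cV[R]_m) :
  affine_in G id ->
  exists m' (G' : R -> 'cV[R]_m'),
    [/\ extends (k * (d + d)) G G',
        affine_in G' (fun x => (cheb_approx d k x).1) &
        affine_in G' (fun x => (cheb_approx d k x).2)].
Proof.
move=> Gx; elim: k => [|k [m1 [G1 [ext1 G11 G12]]]].
  by exists m, G; split; [exact: extends_refl | exact: affine_in_cst |].
have [m2 [G2 [ext2 Gp]]] := reaches_mul_approx d (ext1.1 _ Gx) G12.
exists m2, G2; split.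
- by rewrite mulSn addnC; exact: extends_trans ext2.
- exact: ext2.1 _ G12.
- apply: affine_in_ext (affine_in_lin 2 (-1) Gp (ext2.1 _ G11)) => x /=.
  by rewrite mulN1r.
Qed.

Lemma chebyshevT_rec {R : realType} k (x : R) :
  (chebyshevT R k.+2).[x]
  = 2 * (x * (chebyshevT R k.+1).[x]) - (chebyshevT R k).[x].
Proof.
rewrite [chebyshevT R k.+2]/= hornerD hornerN hornerM hornerZ hornerX.
by rewrite mulrA.
Qed.

Lemma chebyshevT_cos {R : realType} k (t : R) :
  (chebyshevT R k).[cos t] = cos (k%:R * t).
Proof.
suff : (chebyshevT R k).[cos t] = cos (k%:R * t) /\
    (chebyshevT R k.+1).[cos t] = cos (k.+1%:R * t) by case.
elim: k => [|k [IH0 IH1]].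
  by rewrite mul0r cos0 mul1r /= hornerC hornerX.
split=> //; rewrite chebyshevT_rec IH0 IH1.
have -> : k.+2%:R * t = k.+1%:R * t + t by rewrite -[k.+2%:R]natr1; ring.
have -> : k%:R * t = k.+1%:R * t - t by rewrite -[k.+1%:R]natr1; ring.
by rewrite cosB cosD; ring.
Qed.

(** The bound follows from [T_k (cos t) = cos (k t)]. *)
Lemma chebyshevT_le1 {R : realType} k (x : R) :
  `|x| <= 1 -> `|(chebyshevT R k).[x]| <= 1.
Proof.
move=> x1.
have <- : cos (acos x) = x by apply: acosK; rewrite in_itv /= -ler_norml.
by rewrite chebyshevT_cos cos_max.
Qed.

(** The smallness hypothesis keeps the approximate values within [[-2, 2]], the
    range in which the approximate product is accurate. *)
Lemma cheb_approx_err {R : realType} d k (x : R) :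
  `|x| <= 1 -> 4 ^+ k * (16 * 4^-1 ^+ d) <= 1 :> R ->
  `|(cheb_approx d k x).1 - (chebyshevT R k).[x]|
    <= 4 ^+ k * (16 * 4^-1 ^+ d) /\
  `|(cheb_approx d k x).2 - (chebyshevT R k.+1).[x]|
    <= 4 ^+ k.+1 * (16 * 4^-1 ^+ d).
Proof.
move=> x1; set e := 16 * _.
have e0 : 0 <= e by rewrite mulr_ge0 // exprn_ge0 // invr_ge0.
elim: k => [|k IH] small.
  rewrite /= hornerC hornerX !subrr normr0.
  by split; rewrite mulr_ge0 // exprn_ge0.
have p1 : 1 <= 4 ^+ k :> R by rewrite exprn_ege1 ?ler1n.
have {IH} [|err0 err1] := IH.
  rewrite (le_trans _ small) // ler_wpM2r // exprS.
  by rewrite ler_peMl ?ler1n ?exprn_ge0.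
split=> //.
have err1' := le_trans err1 small.
have t2 : `|(cheb_approx d k x).2| <= 2.
  rewrite -[X in `|X|](subrK (chebyshevT R k.+1).[x]).
  by rewrite (le_trans (ler_normD _ _)) // (lerD err1') // chebyshevT_le1.
have mulerr := mul_approx_err d x1 t2.
have xerr : `|x * ((cheb_approx d k x).2 - (chebyshevT R k.+1).[x])|
    <= 4 ^+ k.+1 * e.
  by rewrite normrM (le_trans _ err1) // ler_piMl.
rewrite chebyshevT_rec.
have -> : (cheb_approx d k.+1 x).2
  = 2 * mul_approx d x (cheb_approx d k x).2 - (cheb_approx d k x).1 by [].
have pe : e <= 4 ^+ k * e by rewrite ler_peMl.
move: mulerr xerr err0; rewrite ![4 ^+ _.+1]exprS -!mulrA !ler_norml mulrBr.
have : 8 * 4^-1 ^+ d = e / 2 by rewrite /e; field.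
move=> ->; lra.
Qed.

(** * Accuracy and size *)

Lemma Linfty_norm_le {R : realType} (A : set R) (f : R -> R) (c : R) :
  0 <= c -> (forall x, A x -> `|f x| <= c) -> (Linfty_norm A f <= c%:E)%E.
Proof.
move=> c0 fc; rewrite /Linfty_norm unlock.
case: ifP => _; last by rewrite lee_fin.
apply/ess_supP/aeW => x /=.
rewrite lee_fin patchE; case: ifPn => [/set_mem/fc //|_].
by rewrite normr0.
Qed.

Lemma ln2_gt0 {R : realType} : 0 < ln 2 :> R.
Proof. by rewrite ln_gt0 // ltr1n. Qed.

Lemma log2_ge0 {R : realType} (y : R) : 1 <= y -> 0 <= log2 y.
Proof. by move=> y1; rewrite divr_ge0 // ln_ge0 // ler1n. Qed.

(** A power of 2 exceeding [y] can be taken with exponent at most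
    [log2 y + 1]. *)
Lemma log2_exponent {R : realType} (y : R) : 1 <= y ->
  exists j : nat, y <= 2 ^+ j /\ j%:R <= log2 y + 1.
Proof.
move=> y1; have y0 : 0 < y by exact: lt_le_trans y1.
have l0 := log2_ge0 y1.
exists (Num.truncn (log2 y)).+1; split; last first.
  by rewrite -natr1 lerD2r truncn_le.
rewrite -ler_ln ?posrE ?exprn_gt0 // lnXn // -[ln 2 *+ _]mulr_natl.
by rewrite -ler_pdivrMr ?ln2_gt0 // ltW // truncnS_gt.
Qed.

Lemma log2_le {R : realType} (y z : R) : 0 < y -> y <= z -> log2 y <= log2 z.
Proof.
move=> y0 yz; rewrite /log2 ler_pM2r ?invr_gt0 ?ln2_gt0 //.
by rewrite ler_ln ?posrE // (lt_le_trans y0).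
Qed.

Theorem proposition2p4 (R : realType) :
  exists c : R, 0 < c /\
    forall (eps : R) (n : nat), 0 < eps -> eps < 1 -> (2 <= n)%N ->
    exists N : relu_net R n,
      [/\ (net_depth N)%:R <= c * (n%:R * log2 (n%:R / eps) + n%:R ^+ 2),
          (net_size N)%:R <= c * (n%:R * log2 (n%:R / eps) + n%:R ^+ 2) &
          (Linfty_norm `[(-1)%R, 1%R]
             (fun x => net_eval N (const_mx x) - (chebyshevT R n).[x])%R
           <= eps%:E)%E].
Proof.
(* The size is 2 n (n + 3 + j) for the degree n + 1, with
   j <= log2 (1 / eps) + 1; comparing with c (n + 1) (log2 ... + n + 1),
   c = 5 is enough. *)
exists 5; split=> // eps [//|n] eps0 eps1 n2.
have ieps1 : 1 <= eps^-1 by rewrite invf_ge1 // ltW.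
have [j [epsj jlog]] := log2_exponent ieps1.
(* 4 ^ - (n + 1) offsets the growth of the error along the recurrence, 4 ^ - 2
   the constant 16, and 4 ^ - j leaves the accuracy eps. *)
pose d := (n.+1 + 2 + j)%N.
have [m [G [ext _ [a [b outE]]]]] :=
  reaches_cheb_approx d n (@affine_in_input R n).
have [N [evalN sizeN]] := ext.2 (Output a b).
have size_le : (net_size N)%:R
    <= 5 * (n.+1%:R * log2 (n.+1%:R / eps) + n.+1%:R ^+ 2) :> R.
  have llog : log2 eps^-1 <= log2 (n.+1%:R / eps).
    by apply: log2_le; rewrite ?invr_gt0 // ler_peMl ?ler1n ?invr_ge0 ?ltW.
  have l0 := le_trans (log2_ge0 ieps1) llog.
  rewrite sizeN addn0 natrM natrD /d !natrD -[n.+1%:R]natr1.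
  have : 1 <= n%:R :> R by rewrite ler1n.
  move: jlog llog l0; rewrite -[n.+1%:R]natr1.
  move: (log2 _) (log2 _) => l l' jl ll l0 n1.
  have : j%:R <= l' + 1 by lra.
  nra.
exists N; split=> //.
  by apply: le_trans size_le; rewrite ler_nat net_depth_le_size.
apply: Linfty_norm_le => [|x]; first exact: ltW.
rewrite /= in_itv /= -ler_norml => x1.
rewrite evalN /= -outE.
have err : 4 ^+ n.+1 * (16 * 4^-1 ^+ d) <= eps.
  rewrite /d 2!exprD [4^-1 ^+ n.+1]exprVn.
  have -> : 4 ^+ n.+1 * (16 * ((4 ^+ n.+1)^-1 * 4^-1 ^+ 2 * 4^-1 ^+ j))
      = 4^-1 ^+ j :> R by field; rewrite expf_neq0.
  rewrite exprVn -[leRHS]invrK lef_pV2 ?posrE ?invr_gt0 ?exprn_gt0 //.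
  by rewrite (le_trans epsj) // lerXn2r ?nnegrE ?ler_nat.
have [|_ e2] := @cheb_approx_err R d n x x1; last exact: le_trans err.
apply: le_trans (le_trans err (ltW eps1)).
rewrite ler_wpM2r ?mulr_ge0 ?exprn_ge0 ?invr_ge0 //.
by rewrite exprS ler_peMl ?exprn_ge0 ?ler1n.
Qed.
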